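(* If the sequent $\Gamma \vdash \Delta$ is provable in the classical sequent calculus then $\Gamma^{K^+}, \neg \Delta^{K^-} \vdash$ is provable in the intuitionistic sequent calculus.
   Context: First-order logic with connectives $\wedge,\vee,\Rightarrow,\neg$ and quantifiers $\forall,\exists$. The classical sequent calculus is the usual cut-free multi-conclusion sequent calculus (sequents $\Gamma\vdash\Delta$ of multisets, axiom $\Gamma,A\vdash A,\Delta$, left/right rules for each connective and quantifier, contraction and weakening on both sides, no cut). The intuitionistic sequent calculus is its cut-free restriction where the right-hand side contains at most one formula (no right contraction, $\Delta$ empty in the axiom and in the first premiss of $\Rightarrow_L$, and $\vee_R$ split into two rules choosing a disjunct). The polarized Kolmogorov translations are defined by induction: for $A$ atomic, $A^{K^+}\equiv A$ and $A^{K^-}\equiv A$; $(A\wedge B)^{K^+}\equiv A^{K^+}\wedge B^{K^+}$, $(A\wedge B)^{K^-}\equiv \neg\neg A^{K^-}\wedge\neg\neg B^{K^-}$; $(A\vee B)^{K^+}\equiv A^{K^+}\vee B^{K^+}$, $(A\vee B)^{K^-}\equiv \neg\neg A^{K^-}\vee\neg\neg B^{K^-}$; $(A\Rightarrow B)^{K^+}\equiv \neg\neg A^{K^-}\Rightarrow B^{K^+}$, $(A\Rightarrow B)^{K^-}\equiv A^{K^+}\Rightarrow\neg\neg B^{K^-}$; $(\neg A)^{K^+}\equiv\neg A^{K^-}$, $(\neg A)^{K^-}\equiv\neg A^{K^+}$; $(\forall x A)^{K^+}\equiv\forall x A^{K^+}$, $(\forall x A)^{K^-}\equiv\forall x\neg\neg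 A^{K^-}$; $(\exists x A)^{K^+}\equiv\exists x A^{K^+}$, $(\exists x A)^{K^-}\equiv\exists x\neg\neg A^{K^-}$. Translations and negations of multisets are applied formula by formula. *)

(* Defs.v *)
From Stdlib Require Import List Permutation.
From Stdlib Require Vector.
Import ListNotations.

Set Implicit Arguments.

(* Single-sorted first-order logic over an arbitrary signature. *)

Record signature : Type := Signature {
  fun_sym : Type;
  fun_arity : fun_sym -> nat;
  pred_sym : Type;
  pred_arity : pred_sym -> nat
}.

(* Variables are de Bruijn indices, so that formulas are identified up to
   renaming of bound variables: [var n] refers to the [n]-th enclosing binder,
   counted from 0, or is free if there is none. *)
Inductive term (Sig : signature) : Type :=
| var : nat -> term Sig
| app : forall f : fun_sym Sig, Vector.t (term Sig) (fun_arity Sig f) -> term Sig.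

Arguments var {Sig} n.
Arguments app {Sig} f ts.

Inductive form (Sig : signature) : Type :=
| Atom : forall p : pred_sym Sig, Vector.t (term Sig) (pred_arity Sig p) -> form Sig
| And : form Sig -> form Sig -> form Sig
| Or : form Sig -> form Sig -> form Sig
| Imp : form Sig -> form Sig -> form Sig
| Neg : form Sig -> form Sig
| All : form Sig -> form Sig
| Ex : form Sig -> form Sig.

Arguments Atom {Sig} p ts.

Fixpoint tsubst (Sig : signature) (s : nat -> term Sig) (t : term Sig) : term Sig :=
  match t with
  | var n => s n
  | app f ts => app f (Vector.map (tsubst s) ts)
  end.

Definition up (Sig : signature) (s : nat -> term Sig) (n : nat) : term Sig :=
  match n with
  | 0 => var 0
  | S m => tsubst (fun k => var (S k)) (s m)
  end.

Fixpoint subst (Sig : signature) (s : nat -> term Sig) (A : form Sig) : form Sig :=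
  match A with
  | Atom p ts => Atom p (Vector.map (tsubst s) ts)
  | And B C => And (subst s B) (subst s C)
  | Or B C => Or (subst s B) (subst s C)
  | Imp B C => Imp (subst s B) (subst s C)
  | Neg B => Neg (subst s B)
  | All B => All (subst (up s) B)
  | Ex B => Ex (subst (up s) B)
  end.

(* [inst t A] is A[t/x], where x is the variable bound by the quantifier whose
   body is [A]. *)
Definition inst (Sig : signature) (t : term Sig) (A : form Sig) : form Sig :=
  subst (fun n => match n with 0 => t | S m => var m end) A.

Definition lift (Sig : signature) (A : form Sig) : form Sig :=
  subst (fun n => var (S n)) A.

(* Multisets are lists up to permutation, via the rules [LK_perm] and [LJ_perm].
   In the rules with an eigenvariable ([LK_AllR], [LK_ExL], [LJ_AllR], [LJ_ExL])
   the eigenvariable is index 0 of the premiss: it is fresh because the rest of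
   the sequent is lifted, and the body of the quantifier, read outside its
   binder, is already its instance at that variable. *)
Inductive LK {Sig : signature} : list (form Sig) -> list (form Sig) -> Prop :=
| LK_perm : forall G G' D D',
    Permutation G G' -> Permutation D D' -> LK G D -> LK G' D'
| LK_ax : forall G D A, LK (A :: G) (A :: D)
| LK_AndL : forall G D A B, LK (A :: B :: G) D -> LK (And A B :: G) D
| LK_AndR : forall G D A B,
    LK G (A :: D) -> LK G (B :: D) -> LK G (And A B :: D)
| LK_OrL : forall G D A B,
    LK (A :: G) D -> LK (B :: G) D -> LK (Or A B :: G) D
| LK_OrR : forall G D A B, LK G (A :: B :: D) -> LK G (Or A B :: D)
| LK_ImpL : forall G D A B,
    LK G (A :: D) -> LK (B :: G) D -> LK (Imp A B :: G) D
| LK_ImpR : forall G D A B, LK (A :: G) (B :: D) -> LK G (Imp A B :: D)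
| LK_NegL : forall G D A, LK G (A :: D) -> LK (Neg A :: G) D
| LK_NegR : forall G D A, LK (A :: G) D -> LK G (Neg A :: D)
| LK_AllL : forall G D A t, LK (inst t A :: G) D -> LK (All A :: G) D
| LK_AllR : forall G D A,
    LK (map (@lift Sig) G) (A :: map (@lift Sig) D) -> LK G (All A :: D)
| LK_ExL : forall G D A,
    LK (A :: map (@lift Sig) G) (map (@lift Sig) D) -> LK (Ex A :: G) D
| LK_ExR : forall G D A t, LK G (inst t A :: D) -> LK G (Ex A :: D)
| LK_contrL : forall G D A, LK (A :: A :: G) D -> LK (A :: G) D
| LK_contrR : forall G D A, LK G (A :: A :: D) -> LK G (A :: D)
| LK_weakL : forall G D A, LK G D -> LK (A :: G) D
| LK_weakR : forall G D A, LK G D -> LK G (A :: D).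

(* A right-hand side with at most one formula is an [option]. *)
Inductive LJ {Sig : signature} : list (form Sig) -> option (form Sig) -> Prop :=
| LJ_perm : forall G G' D, Permutation G G' -> LJ G D -> LJ G' D
| LJ_ax : forall G A, LJ (A :: G) (Some A)
| LJ_AndL : forall G D A B, LJ (A :: B :: G) D -> LJ (And A B :: G) D
| LJ_AndR : forall G A B,
    LJ G (Some A) -> LJ G (Some B) -> LJ G (Some (And A B))
| LJ_OrL : forall G D A B,
    LJ (A :: G) D -> LJ (B :: G) D -> LJ (Or A B :: G) D
| LJ_OrR1 : forall G A B, LJ G (Some A) -> LJ G (Some (Or A B))
| LJ_OrR2 : forall G A B, LJ G (Some B) -> LJ G (Some (Or A B))
| LJ_ImpL : forall G D A B,
    LJ G (Some A) -> LJ (B :: G) D -> LJ (Imp A B :: G) D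
| LJ_ImpR : forall G A B, LJ (A :: G) (Some B) -> LJ G (Some (Imp A B))
| LJ_NegL : forall G A, LJ G (Some A) -> LJ (Neg A :: G) None
| LJ_NegR : forall G A, LJ (A :: G) None -> LJ G (Some (Neg A))
| LJ_AllL : forall G D A t, LJ (inst t A :: G) D -> LJ (All A :: G) D
| LJ_AllR : forall G A, LJ (map (@lift Sig) G) (Some A) -> LJ G (Some (All A))
| LJ_ExL : forall G D A,
    LJ (A :: map (@lift Sig) G) (option_map (@lift Sig) D) -> LJ (Ex A :: G) D
| LJ_ExR : forall G A t, LJ G (Some (inst t A)) -> LJ G (Some (Ex A))
| LJ_contrL : forall G D A, LJ (A :: A :: G) D -> LJ (A :: G) D
| LJ_weakL : forall G D A, LJ G D -> LJ (A :: G) D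
| LJ_weakR : forall G A, LJ G None -> LJ G (Some A).

Fixpoint Kpos (Sig : signature) (A : form Sig) : form Sig :=
  match A with
  | Atom p ts => Atom p ts
  | And B C => And (Kpos B) (Kpos C)
  | Or B C => Or (Kpos B) (Kpos C)
  | Imp B C => Imp (Neg (Neg (Kneg B))) (Kpos C)
  | Neg B => Neg (Kneg B)
  | All B => All (Kpos B)
  | Ex B => Ex (Kpos B)
  end
with Kneg (Sig : signature) (A : form Sig) : form Sig :=
  match A with
  | Atom p ts => Atom p ts
  | And B C => And (Neg (Neg (Kneg B))) (Neg (Neg (Kneg C)))
  | Or B C => Or (Neg (Neg (Kneg B))) (Neg (Neg (Kneg C)))
  | Imp B C => Imp (Kpos B) (Neg (Neg (Kneg C)))
  | Neg B => Neg (Kpos B)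
  | All B => All (Neg (Neg (Kneg B)))
  | Ex B => Ex (Neg (Neg (Kneg B)))
  end.

(* Main.v *)
Require Import Defs.
From Stdlib Require Import List.
From Stdlib Require Import Permutation.

(** A proof of [G |- D] is translated rule by rule, by induction. A right rule on
    [A] becomes a left negation rule on [~ A^K-], followed by the corresponding
    intuitionistic right rule; the double negations inside [A^K-] then send the
    subformulas back to the left of the sequent, as negations. The axiom needs
    [A^K+ |- A^K-], by induction on [A]. *)

Lemma tsubst_tsubst {Sig : signature} (s r : nat -> term Sig) (t : term Sig) :
  tsubst s (tsubst r t) = tsubst (fun n => tsubst s (r n)) t.
Proof.
  (* The arguments of [app] form a vector of terms, so the induction is nested: [IH] recurses on
     subterms inside an induction on [ts]. *)
  revert t; fix IH 1; intros [n | f ts]; simpl; [reflexivity |].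
  f_equal; induction ts as [| t n ts IHts]; simpl; [reflexivity |].
  rewrite IH, IHts; reflexivity.
Qed.

Lemma tsubst_cancel {Sig : signature} (s r : nat -> term Sig) (t : term Sig) :
  (forall n, tsubst s (r n) = var n) -> tsubst s (tsubst r t) = t.
Proof.
  intros H; revert t; fix IH 1; intros [n | f ts]; simpl; [apply H |].
  f_equal; induction ts as [| t n ts IHts]; simpl; [reflexivity |].
  rewrite IH, IHts; reflexivity.
Qed.

Lemma up_cancel {Sig : signature} (s r : nat -> term Sig) :
  (forall n, tsubst s (r n) = var n) -> forall n, tsubst (up s) (up r n) = var n.
Proof.
  intros H [| n]; simpl; [reflexivity |].
  rewrite tsubst_tsubst; simpl.
  rewrite <- (tsubst_tsubst (fun k => var (S k)) s), H; reflexivity.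
Qed.

Lemma subst_cancel {Sig : signature} (A : form Sig) (s r : nat -> term Sig) :
  (forall n, tsubst s (r n) = var n) -> subst s (subst r A) = A.
Proof.
  revert s r; induction A as [p ts | | | | | |]; intros s r H; simpl;
    f_equal; auto using up_cancel.
  induction ts as [| t n ts IHts]; simpl; [reflexivity |].
  rewrite IHts, tsubst_cancel; auto.
Qed.

(** For the eigenvariable steps: lifting a quantified formula lifts its body under the binder, and
    instantiating that at the eigenvariable 0 undoes the lift. *)
Lemma inst_var0_lift_body {Sig : signature} (A : form Sig) :
  inst (var 0) (subst (up (fun n => var (S n))) A) = A.
Proof. apply subst_cancel; intros [| n]; reflexivity. Qed.

(** Both polarities go together because implication and negation swap them; [s] varies because
    quantifiers turn it into [up s]. *)
Lemma K_subst {Sig : signature} (A : form Sig) (s : nat -> term Sig) :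
  Kpos (subst s A) = subst s (Kpos A) /\ Kneg (subst s A) = subst s (Kneg A).
Proof.
  revert s; induction A as [p ts | A IHA B IHB | A IHA B IHB | A IHA B IHB
                           | A IHA | A IHA | A IHA]; intros s; simpl;
    try destruct (IHA s) as [-> ->]; try destruct (IHB s) as [-> ->];
    try destruct (IHA (up s)) as [-> ->]; auto.
Qed.

Lemma Kpos_inst {Sig : signature} (t : term Sig) (A : form Sig) :
  Kpos (inst t A) = inst t (Kpos A).
Proof. apply K_subst. Qed.

Lemma Kneg_inst {Sig : signature} (t : term Sig) (A : form Sig) :
  Kneg (inst t A) = inst t (Kneg A).
Proof. apply K_subst. Qed.

Lemma LJ_exchange {Sig : signature} (G : list (form Sig)) D A B :
  LJ (B :: A :: G) D -> LJ (A :: B :: G) D.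
Proof. apply LJ_perm, perm_swap. Qed.

Lemma LJ_NegNegR {Sig : signature} (G : list (form Sig)) A :
  LJ G (Some A) -> LJ G (Some (Neg (Neg A))).
Proof. intros H; apply LJ_NegR, LJ_NegL, H. Qed.

(** On the left of an implication and under a negation the polarities swap, so the hypothesis is
    needed there in the same direction, and the converse entailment never arises. *)
Lemma LJ_Kpos_Kneg {Sig : signature} (A : form Sig) (G : list (form Sig)) :
  LJ (Kpos A :: G) (Some (Kneg A)).
Proof.
  revert G; induction A as [p ts | A IHA B IHB | A IHA B IHB | A IHA B IHB
                           | A IHA | A IHA | A IHA]; intros G; simpl.
  - apply LJ_ax.
  - apply LJ_AndL, LJ_AndR; apply LJ_NegNegR; [| apply LJ_exchange]; auto.
  - apply LJ_OrL; [apply LJ_OrR1 | apply LJ_OrR2]; apply LJ_NegNegR; auto.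
  - apply LJ_ImpR, LJ_exchange, LJ_ImpL; apply LJ_NegNegR; auto.
  - apply LJ_NegR, LJ_exchange, LJ_NegL; auto.
  - apply LJ_AllR; simpl.
    apply LJ_AllL with (t := var 0); rewrite inst_var0_lift_body.
    apply LJ_NegNegR; auto.
  - apply LJ_ExL; simpl.
    apply LJ_ExR with (t := var 0); simpl.
    change (LJ (Kpos A :: map (@lift Sig) G) (Some (Neg (Neg
      (inst (var 0) (subst (up (fun n => var (S n))) (Kneg A))))))).
    rewrite inst_var0_lift_body; apply LJ_NegNegR; auto.
Qed.

Definition Kseq {Sig : signature} (G D : list (form Sig)) : list (form Sig) :=
  map (@Kpos Sig) G ++ map (@Neg Sig) (map (@Kneg Sig) D).

Lemma Kseq_consR {Sig : signature} (G D : list (form Sig)) A :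
  Permutation (Neg (Kneg A) :: Kseq G D) (Kseq G (A :: D)).
Proof. apply Permutation_middle. Qed.

(** Brings the negation of a right-hand formula to the head, where left rules act, or puts it back
    to match an induction hypothesis. *)
Lemma LJ_Kseq_consR {Sig : signature} (G D : list (form Sig)) A C :
  LJ (Neg (Kneg A) :: Kseq G D) C <-> LJ (Kseq G (A :: D)) C.
Proof.
  split; apply LJ_perm; [| apply Permutation_sym]; apply Kseq_consR.
Qed.

Lemma LJ_Kseq_consR2 {Sig : signature} (G D : list (form Sig)) A B C :
  LJ (Kseq G (A :: B :: D)) C -> LJ (Neg (Kneg A) :: Neg (Kneg B) :: Kseq G D) C.
Proof.
  apply LJ_perm; apply Permutation_sym.
  rewrite Kseq_consR; apply Kseq_consR.
Qed.

(** Carries the freshness of the eigenvariable over to the translated sequent. *)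
Lemma Kseq_lift {Sig : signature} (G D : list (form Sig)) :
  Kseq (map (@lift Sig) G) (map (@lift Sig) D) = map (@lift Sig) (Kseq G D).
Proof.
  unfold Kseq; rewrite map_app, !map_map.
  f_equal; apply map_ext; intros A; unfold lift; simpl; f_equal; apply K_subst.
Qed.

Theorem theorem1 (Sig : signature) (G D : list (form Sig)) :
  LK G D -> LJ (map (@Kpos Sig) G ++ map (@Neg Sig) (map (@Kneg Sig) D)) None.
Proof.
  change (LK G D -> LJ (Kseq G D) None).
  induction 1 as [G G' D D' PG PD _ IH | G D A | G D A B _ IH
    | G D A B _ IHA _ IHB | G D A B _ IHA _ IHB | G D A B _ IH
    | G D A B _ IHA _ IHB | G D A B _ IH | G D A _ IH | G D A _ IH
    | G D A t _ IH | G D A _ IH | G D A _ IH | G D A t _ IH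
    | G D A _ IH | G D A _ IH | G D A _ IH | G D A _ IH].
  - revert IH; apply LJ_perm.
    apply Permutation_app; repeat apply Permutation_map; assumption.
  - apply LJ_Kseq_consR, LJ_NegL, LJ_Kpos_Kneg.
  - apply LJ_AndL, IH.
  - apply LJ_Kseq_consR, LJ_NegL, LJ_AndR; apply LJ_NegR, LJ_Kseq_consR; assumption.
  - apply LJ_OrL; assumption.
  (* Each intuitionistic right rule keeps one disjunct only, so the negated disjunction is
     duplicated: one copy yields [A], the other [B]. *)
  - apply LJ_Kseq_consR, LJ_contrL, LJ_NegL, LJ_OrR1, LJ_NegR, LJ_exchange.
    apply LJ_NegL, LJ_OrR2, LJ_NegR, LJ_exchange, LJ_Kseq_consR2, IH.
  (* The double negation in the positive translation of [Imp A B] lets the first premiss, which has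
     a right-hand formula, go back to an empty right side. *)
  - apply LJ_ImpL; [apply LJ_NegR, LJ_Kseq_consR |]; assumption.
  - apply LJ_Kseq_consR, LJ_NegL, LJ_ImpR, LJ_NegR.
    apply (LJ_Kseq_consR (A :: G)), IH.
  (* Premiss and conclusion translate to the same sequent up to permutation. *)
  - apply LJ_Kseq_consR, IH.
  - apply LJ_Kseq_consR, LJ_NegL, LJ_NegR, IH.
  - apply LJ_AllL with (t := t); rewrite <- Kpos_inst; exact IH.
  - apply LJ_Kseq_consR, LJ_NegL, LJ_AllR, LJ_NegR.
    rewrite <- Kseq_lift; apply LJ_Kseq_consR, IH.
  - apply LJ_ExL; change (LJ (Kpos A :: map (@lift Sig) (Kseq G D)) None); rewrite <- Kseq_lift; exact IH.
  - apply LJ_Kseq_consR, LJ_NegL, LJ_ExR with (t := t), LJ_NegR.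
    change (LJ (Neg (inst t (Kneg A)) :: Kseq G D) None).
    rewrite <- Kneg_inst; apply LJ_Kseq_consR, IH.
  - apply LJ_contrL, IH.
  - apply LJ_Kseq_consR, LJ_contrL, LJ_Kseq_consR2, IH.
  - apply LJ_weakL, IH.
  - apply LJ_Kseq_consR, LJ_weakL, IH.
Qed.
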